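(* (Hales–Jewett theorem.) Let $n$, $t$ and $k$ be positive integers. Then there is a positive integer $N$ such that whenever $\mathrm{Chain}_t(N)$ is colored with $k$ colors, there is a lattice homothety $h:\mathrm{Chain}_t(n)\to\mathrm{Chain}_t(N)$ of type HJ whose image is monochromatic.
   Context: A finite poset $P$ is graded if it carries a rank function $r_P:P\to\mathbb N_0$ that is strictly increasing and satisfies $r_P(p')=r_P(p)+1$ whenever $p'$ covers $p$; a graded lattice is a lattice that is graded as a poset. Lattice homothety: for graded lattices $P,Q$, a map $f:P\to Q$ such that (a) $f(p)\le f(p')$ if and only if $p\le p'$, (b) there is $d\ge 1$ (the scale factor) with $r_Q(f(p))-r_Q(f(p'))=d\,(r_P(p)-r_P(p'))$ for all $p,p'\in P$, and (c) $f(p\vee p')=f(p)\vee f(p')$, $f(p\wedge p')=f(p)\wedge f(p')$ for all $p,p'\in P$. Chain lattices: for positive integers $t,n$, $\mathrm{Chain}_t(n)$ is the set of all maps $\{1,\ldots,n\}\to\{0,\ldots,t-1\}$ (written also as tuples $(a_1,\ldots,a_n)$) with the pointwise order; it is a graded lattice with join the pointwise max, meet the pointwise min, and rank function $r(f)=\sum_{x}f(x)$. Type HJ: let $\mathcal S=\{S_1,\ldots,S_n\}$ be a family of $n$ pairwise disjoint subsets of $[N]=\{1,\ldots,N\}$ with $|S_1|=\cdots=|S_n|$ and let $\alpha:[N]\to\{0,\ldots,t-1\}$ be a function vanishing on $S_1\cup\cdots\cup S_n$. Define $\varphi_{\mathcal S,\alpha}:\mathrm{Chain}_t(n)\to\mathrm{Chain}_t(N)$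 by $\varphi_{\mathcal S,\alpha}(a_1,\ldots,a_n)=a_1 1_{S_1}+\cdots+a_n1_{S_n}+\alpha$, where $1_S$ is the indicator function of $S$. A lattice homothety $h:\mathrm{Chain}_t(n)\to\mathrm{Chain}_t(N)$ is of type HJ if $h=\varphi_{\mathcal S,\alpha}$ for some such $\mathcal S$ and $\alpha$. *)

(* Defs.v *)
From HB Require Import structures.
From mathcomp Require Import all_boot all_order all_algebra.

Set Implicit Arguments.
Unset Strict Implicit.
Unset Printing Implicit Defensive.

Import Order.TTheory GRing.Theory Num.Theory.
Local Open Scope order_scope.

Definition covers (d : Order.disp_t) (P : porderType d) (p' p : P) : Prop :=
  p < p' /\ ~ exists q : P, p < q /\ q < p'.

HB.mixin Record FinLattice_isGraded (d : Order.disp_t) T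
    of Order.FinLattice d T := {
  rank : T -> nat;
  rank_lt : forall p q : T, p < q -> (rank p < rank q)%N;
  rank_covers : forall p p' : T, covers p' p -> rank p' = (rank p + 1)%N
}.

#[short(type="finGradedLatticeType")]
HB.structure Definition FinGradedLattice (d : Order.disp_t) :=
  { T of Order.FinLattice d T & FinLattice_isGraded d T }.

(* The differences of ranks may be negative, hence the casts to int. *)
Definition lattice_homothety (dP dQ : Order.disp_t)
    (P : finGradedLatticeType dP) (Q : finGradedLatticeType dQ)
    (f : P -> Q) : Prop :=
  [/\ forall p p' : P, f p <= f p' <-> p <= p',
      exists2 d : nat, (1 <= d)%N &
        forall p p' : P,
          ((rank (f p))%:Z - (rank (f p'))%:Z
             = d%:Z * ((rank p)%:Z - (rank p')%:Z))%R
    & forall p p' : P,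
        f (p `|` p') = f p `|` f p' /\ f (p `&` p') = f p `&` f p'].

(* Tuples with the componentwise order; positions and values are numbered
   from 0. *)
Definition chain (t n : nat) : Type := n.-tupleprod 'I_t.

Section ChainGraded.
Variables t n : nat.

HB.instance Definition _ := Order.FinLattice.copy (chain t n) (n.-tupleprod 'I_t).

Implicit Types a b : chain t n.

Definition chain_rank a : nat := \sum_(x < n) tnth a x.

Lemma chain_leP a b : reflect (forall x, (tnth a x <= tnth b x)%N) (a <= b).
Proof. by rewrite leEtprod; exact: forallP. Qed.

Lemma chain_joinE a b x :
  tnth (a `|` b) x = maxn (tnth a x) (tnth b x) :> nat.
Proof.
rewrite joinEtprod tnth_mktuple; case: (leP (tnth a x) (tnth b x)) => h.
  by rewrite (maxn_idPr h).
by rewrite (maxn_idPl (ltnW h)).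
Qed.

Lemma chain_meetE a b x :
  tnth (a `&` b) x = minn (tnth a x) (tnth b x) :> nat.
Proof.
rewrite meetEtprod tnth_mktuple; case: (leP (tnth a x) (tnth b x)) => h.
  by rewrite (minn_idPl h).
by rewrite (minn_idPr (ltnW h)).
Qed.

Lemma chain_lt_ex a b : a < b -> exists x, (tnth a x < tnth b x)%N.
Proof.
move=> ltab; apply/existsP; apply: contraT; rewrite negb_exists => /forallP h.
have leba : b <= a by apply/chain_leP => x; rewrite leqNgt h.
by rewrite (lt_geF ltab) in leba.
Qed.

Lemma chain_rank_lt a b : a < b -> (chain_rank a < chain_rank b)%N.
Proof.
move=> ltab; have [x ltx] := chain_lt_ex ltab.
have /chain_leP leab := ltW ltab.
rewrite /chain_rank (bigD1 x) //= [ltnRHS](bigD1 x) //= -addSn.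
by apply: leq_add => //; apply: leq_sum => y _; exact: leab.
Qed.

Lemma chain_rank_covers a b : covers b a -> chain_rank b = (chain_rank a + 1)%N.
Proof.
case=> ltab noq; have [x ltx] := chain_lt_ex ltab.
have /chain_leP leab := ltW ltab.
have ltt : ((tnth a x).+1 < t)%N := leq_ltn_trans ltx (ltn_ord _).
pose q : chain t n :=
  [tuple (if y == x then Ordinal ltt else tnth a y) | y < n].
have qE y : tnth q y = (tnth a y + (y == x))%N :> nat.
  rewrite tnth_mktuple; case: eqP => [->|_] /=; last by rewrite addn0.
  by rewrite addn1.
have leaq : a <= q by apply/chain_leP => y; rewrite qE leq_addr.
have leqb : q <= b.
  apply/chain_leP => y; rewrite qE; case: eqP => [->|_]; first by rewrite addn1.
  by rewrite addn0; exact: leab.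
have neaq : a != q.
  apply/eqP => eaq; have := qE x; rewrite -eaq eqxx addn1 => /eqP.
  by rewrite ltn_eqF.
have <- : q = b.
  apply/eqP/negPn/negP => neqb; apply: noq; exists q.
  by rewrite !lt_neqAle neaq leaq neqb leqb.
rewrite /chain_rank; under eq_bigr do rewrite qE.
rewrite big_split /=; congr (_ + _)%N.
by rewrite (bigD1 x) //= eqxx big1 ?addn0 // => y /negPf ->.
Qed.

HB.instance Definition _ :=
  FinLattice_isGraded.Build _ (chain t n) chain_rank_lt chain_rank_covers.

End ChainGraded.

Record HJ_data (t n N : nat) (S : 'I_n -> {set 'I_N}) (alpha : chain t N) :
    Prop := {
  HJ_disjoint : forall i j : 'I_n, i != j -> [disjoint S i & S j];
  HJ_card : forall i j : 'I_n, #|S i| = #|S j|;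
  HJ_vanish : forall x : 'I_N, x \in \bigcup_(i < n) S i -> tnth alpha x = 0%N :> nat
}.

(* The function phi_{S,alpha}(a), a priori with values in nat; these are < t
   under HJ_data (see HJ_map_lt). *)
Definition HJ_map (t n N : nat) (S : 'I_n -> {set 'I_N}) (alpha : chain t N)
    (a : chain t n) (x : 'I_N) : nat :=
  \sum_(i < n) tnth a i * (x \in S i) + tnth alpha x.

Lemma HJ_map_lt (t n N : nat) (S : 'I_n -> {set 'I_N}) (alpha : chain t N)
    (a : chain t n) (x : 'I_N) :
  HJ_data S alpha -> (HJ_map S alpha a x < t)%N.
Proof.
case=> dS _ vS; rewrite /HJ_map.
have [/bigcupP[i _ xSi]|xS] := boolP (x \in \bigcup_(i < n) S i).
  rewrite vS; last by apply/bigcupP; exists i.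
  rewrite addn0 (bigD1 i) //= xSi muln1 big1 ?addn0 // => j neji.
  by rewrite (disjointFr (dS _ _ _) xSi) ?muln0 // eq_sym.
rewrite big1 ?add0n ?ltn_ord // => i _; suff /negPf-> : x \notin S i by rewrite muln0.
by apply: contra xS => xSi; apply/bigcupP; exists i.
Qed.

Definition type_HJ (t n N : nat) (h : chain t n -> chain t N) : Prop :=
  exists (S : 'I_n -> {set 'I_N}) (alpha : chain t N),
    HJ_data S alpha /\
    forall (a : chain t n) (x : 'I_N), tnth (h a) x = HJ_map S alpha a x :> nat.

Definition monochromatic_image (A B C : Type) (c : B -> C) (h : A -> B) : Prop :=
  exists q : C, forall a : A, c (h a) = q.

(* Main.v *)
(** Colour focusing proves the one-dimensional Hales-Jewett theorem, by
induction on the size of the alphabet.  The theorem then follows by applying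
it to the alphabet [A] of all maps [{1..n} -> {0..t-1}]: a word of length [I]
over [A] is an element of [Chain_t(I * n)], and a line with active set [D]
becomes the map with [S_j = D * {j}], so the sets [S_j] automatically have the
same cardinality. *)
Require Import Defs.
From mathcomp Require Import all_boot all_order.
From mathcomp Require Import zify.

(** * Words and combinatorial lines over a finite alphabet *)

Section Words.
Context {I J A B : finType}.

(* [l i = None] marks the active coordinates of the line [l]. *)
Definition line_pt (l : {ffun I -> option A}) (a : A) : {ffun I -> A} :=
  [ffun i => odflt a (l i)].

Definition const_line (u : {ffun I -> A}) : {ffun I -> option A} :=
  [ffun i => Some (u i)].

Definition map_word (f : A -> B) (u : {ffun I -> A}) : {ffun I -> B} :=
  [ffun i => f (u i)].

Definition map_line (f : A -> B) (l : {ffun I -> option A}) :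
    {ffun I -> option B} :=
  [ffun i => omap f (l i)].

Definition cat_word (u : {ffun I -> A}) (v : {ffun J -> A}) :
    {ffun I + J -> A} :=
  [ffun s => match s with inl i => u i | inr j => v j end].

Lemma line_pt_const u a : line_pt (const_line u) a = u.
Proof. by apply/ffunP => i; rewrite !ffunE. Qed.

End Words.

Lemma line_pt_map (I A B : finType) (f : A -> B) (l : {ffun I -> option A}) a :
  line_pt (map_line f l) (f a) = map_word f (line_pt l a).
Proof. by apply/ffunP => i; rewrite !ffunE; case: (l i). Qed.

Lemma line_pt_cat (I J A : finType) (l : {ffun I -> option A})
    (l' : {ffun J -> option A}) a :
  line_pt (cat_word l l') a = cat_word (line_pt l a) (line_pt l' a).
Proof. by apply/ffunP => -[i|j]; rewrite !ffunE. Qed.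

Definition has_mono_line {I A K : finType} (C : {ffun I -> A} -> K) : Prop :=
  exists2 l : {ffun I -> option A}, exists i, l i = None &
    exists q, forall a, C (line_pt l a) = q.

Definition hales_jewett (A : finType) : Prop :=
  forall K : finType, exists I : finType,
    forall C : {ffun I -> A} -> K, has_mono_line C.

(* [Q] is the set of colours of lines that are monochromatic except at their
   last point, all these lines sharing the last point [e]. *)
Definition color_focused {I A K : finType} (C : {ffun I -> option A} -> K)
    (r : nat) : Prop :=
  exists (e : {ffun I -> option A}) (Q : {set K}), #|Q| = r /\
    forall q, q \in Q -> exists2 l : {ffun I -> option (option A)},
      exists i, l i = None &
      line_pt l None = e /\ forall a, C (line_pt l (Some a)) = q.

(** Induction on [r]: a second block of coordinates is appended to the first, and either a
    monochromatic line appears or one more colour gets focused. *)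
Lemma hales_jewett_focus (A K : finType) (a0 : A) (r : nat) :
  hales_jewett A -> exists I : finType,
    forall C : {ffun I -> option A} -> K,
      has_mono_line C \/ color_focused C r.
Proof.
move=> hjA; elim: r => [|r [I hI]].
  exists void => C; right; exists [ffun=> None], set0; split; first exact: cards0.
  by move=> q; rewrite inE.
(* A word on the second block is coloured by the whole colouring it induces on the first; along the
   line [l'] that induced colouring is a fixed [C']. *)
have [J hJ] := hjA {ffun {ffun I -> option A} -> K}.
exists (I + J)%type => C.
have [l' [j l'j] [C' hC']] :=
  hJ (fun v => [ffun u => C (cat_word u (map_word Some v))]).
have {}hC' u a : C (cat_word u (map_word Some (line_pt l' a))) = C' u.
  by rewrite -(hC' a) ffunE.
pose m := map_line Some l'.
have mE a : line_pt m (Some a) = map_word Some (line_pt l' a).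
  exact: line_pt_map.
have mj : m j = None by rewrite ffunE l'j.
(* The second block may be frozen at any letter of [A], as [hC'] shows that the colour does not
   depend on it. *)
have mono_lift : has_mono_line C' -> has_mono_line C.
  case=> l [i li] [q hq].
  exists (cat_word l (const_line (line_pt m (Some a0)))).
    by exists (inl i); rewrite ffunE.
  by exists q => a; rewrite line_pt_cat line_pt_const mE hC'.
have [/mono_lift|[e [Q [cardQ hQ]]]] := hI C'; first by left.
(* If the focus already has a colour of [Q], it completes the line of that colour. *)
have [eQ|eQ] := boolP (C' e \in Q).
  left; apply: mono_lift; have [l li [le hl]] := hQ _ eQ.
  by exists l => //; exists (C' e) => -[a|]; rewrite ?le.
(* The line of the new colour [C' e] keeps the first block at [e] and moves only the second; the
   lines of the old colours move both blocks at once. All end at the same point. *)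
right; exists (cat_word e (line_pt m None)), (C' e |: Q).
split=> [|q]; first by rewrite cardsU1 eQ cardQ.
rewrite in_setU1 => /orP[/eqP->|/hQ[l [i li] [le hl]]].
  exists (cat_word (const_line e) m); first by exists (inr j); rewrite ffunE.
  split=> [|a]; first by rewrite line_pt_cat line_pt_const.
  by rewrite line_pt_cat line_pt_const mE hC'.
exists (cat_word l m); first by exists (inl i); rewrite ffunE.
split=> [|a]; first by rewrite line_pt_cat le.
by rewrite line_pt_cat mE hC'.
Qed.

Lemma hales_jewett_option (A : finType) (a0 : A) :
  hales_jewett A -> hales_jewett (option A).
Proof.
(* Focusing more colours than [K] has is impossible, which leaves the monochromatic line. *)
move=> hjA K; have [I hI] := hales_jewett_focus A K a0 #|K|.+1 hjA.
exists I => C; have [//|[e [Q [cardQ _]]]] := hI C.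
by have := max_card (mem Q); rewrite cardQ ltnn.
Qed.

(** A colouring is pulled back along [f], and the line found is pushed forward; [g] supplies a
    preimage of each letter. *)
Lemma hales_jewett_surj (A B : finType) (f : A -> B) (g : B -> A) :
  cancel g f -> hales_jewett A -> hales_jewett B.
Proof.
move=> gK hjA K; have [I hI] := hjA K; exists I => C.
have [l [i li] [q hq]] := hI (fun u => C (map_word f u)).
exists (map_line f l); first by exists i; rewrite ffunE li.
by exists q => b; rewrite -(hq (g b)) -line_pt_map gK.
Qed.

Lemma hales_jewett_ord m : hales_jewett 'I_m.+1.
Proof.
elim: m => [|m IHm].
  move=> K; exists unit => C.
  exists [ffun=> None]; first by exists tt; rewrite ffunE.
  by exists (C (line_pt [ffun=> None] ord0)) => a; rewrite (ord1 a).
apply: (hales_jewett_surj _ _ (oapp (lift ord0) ord0) (unlift ord0)) => [i|].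
  by case: unliftP.
exact: hales_jewett_option ord0 IHm.
Qed.

Lemma hales_jewett_finType (A : finType) (a0 : A) : hales_jewett A.
Proof.
have A_gt0 : 0 < #|A| by apply/card_gt0P; exists a0.
pose f (i : 'I_#|A|.-1.+1) := nth a0 (enum A) i.
pose g (a : A) : 'I_#|A|.-1.+1 := inord (index a (enum A)).
apply: (hales_jewett_surj _ _ f g) (hales_jewett_ord _) => a.
rewrite /f inordK ?nth_index ?mem_enum //.
by rewrite prednK // cardE index_mem mem_enum.
Qed.

(** * Type HJ maps as lattice homotheties *)

Section HJHomothety.
Context {t n N : nat} {S : 'I_n -> {set 'I_N}} {alpha : chain t N}.
Hypothesis SP : HJ_data S alpha.

Lemma HJ_map_in (a : chain t n) i x : x \in S i -> HJ_map S alpha a x = tnth a i.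
Proof.
case: SP => dS _ vS xSi; rewrite /HJ_map vS; last by apply/bigcupP; exists i.
rewrite addn0 (bigD1 i) //= xSi muln1 big1 ?addn0 // => j neji.
by rewrite (disjointFr (dS _ _ _) xSi) ?muln0 // eq_sym.
Qed.

Lemma HJ_map_out (a : chain t n) x :
  x \notin \bigcup_(i < n) S i -> HJ_map S alpha a x = tnth alpha x.
Proof.
move=> xS; rewrite /HJ_map big1 // => i _.
suff /negPf-> : x \notin S i by rewrite muln0.
by apply: contra xS => xSi; apply/bigcupP; exists i.
Qed.

Lemma HJ_map_rank (a : chain t n) (i0 : 'I_n) :
  \sum_(x < N) HJ_map S alpha a x = #|S i0| * chain_rank a + chain_rank alpha.
Proof.
rewrite big_split exchange_big /= big_distrr /=; congr (_ + _).
apply: eq_bigr => i _; rewrite -big_distrr /= mulnC; congr (_ * _).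
by rewrite (HJ_card SP i0 i) -sum1_card [RHS]big_mkcond.
Qed.

(** Each coordinate of [h a] is either a copy of one entry of [a] or constant, so order, joins and
    meets carry over. Nonempty [S i] let every entry be read back, and their common size is the
    scale factor. *)
Lemma HJ_homothety (h : chain t n -> chain t N) :
  0 < n -> (forall i, S i != set0) ->
  (forall a x, tnth (h a) x = HJ_map S alpha a x :> nat) ->
  lattice_homothety h.
Proof.
move=> n_gt0 S_neq0 hE; split.
- move=> a b; split=> /chain_leP leab; apply/chain_leP.
    move=> i; have /set0Pn[x xSi] := S_neq0 i.
    by have := leab x; rewrite !hE !(HJ_map_in _ i x).
  by move=> x; rewrite !hE leq_add2r; apply: leq_sum => i _; rewrite leq_mul.
- pose i0 := Ordinal n_gt0; exists #|S i0|; first by rewrite card_gt0.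
  have rankE a : rank (h a) = #|S i0| * rank a + chain_rank alpha.
    by rewrite -HJ_map_rank; apply: eq_bigr => x _; exact: hE.
  by move=> a b; rewrite !rankE; lia.
- move=> a b; split; apply: eq_from_tnth => x; apply: val_inj.
    rewrite /= chain_joinE !hE.
    have [/bigcupP[i _ xSi]|xS] := boolP (x \in \bigcup_(i < n) S i).
      by rewrite !(HJ_map_in _ i x) // chain_joinE.
    by rewrite !HJ_map_out // maxnn.
  rewrite /= chain_meetE !hE.
  have [/bigcupP[i _ xSi]|xS] := boolP (x \in \bigcup_(i < n) S i).
    by rewrite !(HJ_map_in _ i x) // chain_meetE.
  by rewrite !HJ_map_out // minnn.
Qed.

End HJHomothety.

(** * From combinatorial lines to type HJ data *)

Section LineToHJ.
Context {t n : nat} {I : finType}.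
Let N := #|{: I * 'I_n}|.
Let A : finType := {ffun 'I_n -> 'I_t.+1}.

Definition word_chain (u : {ffun I -> A}) : chain t.+1 N :=
  [tuple u (enum_val x).1 (enum_val x).2 | x < N].

Variable l : {ffun I -> option A}.

Definition line_set (j : 'I_n) : {set 'I_N} :=
  [set x | ((enum_val x).2 == j) && (l (enum_val x).1 == None)].

(** Taking the point of the line at the zero letter keeps the fixed letters and vanishes at the
    active coordinates. *)
Definition line_alpha : chain t.+1 N :=
  word_chain (line_pt l [ffun=> ord0]).

Lemma card_line_set j : #|line_set j| = #|[set i | l i == None]|.
Proof.
have -> : line_set j =
    [set enum_rank (i, j) | i in [set i | l i == None]].
  apply/setP => x; rewrite inE; apply/andP/imsetP.
    case=> /eqP <- lx; exists (enum_val x).1; first by rewrite inE.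
    by rewrite -surjective_pairing enum_valK.
  by case=> i; rewrite inE => li ->; rewrite enum_rankK eqxx.
by rewrite card_imset // => i i' /enum_rank_inj[].
Qed.

Lemma line_HJ_data : HJ_data line_set line_alpha.
Proof.
split=> [i j neij|i j|x /bigcupP[j _]].
- apply/pred0P => x /=; rewrite !inE.
  by have [->|] := eqVneq (enum_val x).2 i; rewrite //= (negPf neij) andbF.
- by rewrite !card_line_set.
by rewrite inE tnth_mktuple ffunE => /andP[_ /eqP->]; rewrite ffunE.
Qed.

Lemma line_HJ_map (a : chain t.+1 n) (x : 'I_N) :
  tnth (word_chain (line_pt l [ffun j => tnth a j])) x
    = HJ_map line_set line_alpha a x :> nat.
Proof.
case lx: (l (enum_val x).1) => [v|].
  rewrite HJ_map_out; first by rewrite !tnth_mktuple !ffunE lx.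
  by apply/bigcupP => -[j _]; rewrite inE lx andbF.
rewrite (HJ_map_in line_HJ_data a (enum_val x).2).
  by rewrite tnth_mktuple ffunE lx ffunE.
by rewrite inE lx !eqxx.
Qed.

End LineToHJ.

Theorem corollary4p5 (n t k : nat) (n_gt0 : 0 < n) (t_gt0 : 0 < t) (k_gt0 : 0 < k) :
  exists N : nat, 0 < N /\
    forall c : chain t N -> 'I_k,
      exists h : chain t n -> chain t N,
        [/\ lattice_homothety h, type_HJ h & monochromatic_image c h].
Proof.
case: t t_gt0 => // t _.
have [I hI] := hales_jewett_finType _ ([ffun=> ord0] : {ffun 'I_n -> 'I_t.+1}) 'I_k.
exists #|{: I * 'I_n}|; split=> [|c].
  (* The line found for a constant colouring has an active coordinate, so [I] is nonempty. *)
  have [l [i _] _] := hI (fun=> Ordinal k_gt0).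
  by apply/card_gt0P; exists (i, Ordinal n_gt0).
have [l [i li] [q hq]] := hI (fun u => c (word_chain u)).
exists (fun a => word_chain (line_pt l [ffun j => tnth a j])); split.
- apply: (HJ_homothety (line_HJ_data l)) => // [j|a x].
    by rewrite -card_gt0 card_line_set card_gt0; apply/set0Pn; exists i; rewrite inE li.
  exact: line_HJ_map.
- exists (line_set l), (line_alpha l); split; first exact: line_HJ_data.
  exact: line_HJ_map.
by exists q => a; exact: hq.
Qed.
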